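(* Let $d \ge 5$ be fixed and let $\alpha_{\mathrm{ER}(d)} = \frac{2}{d}(\log d + 2 - \log 2)$. Then for every integer $\tau \ge 1$ that is fixed with respect to $n$, $$\mathbb{P}\left[\alpha^{\tau}(\mathrm{ER}(n,d/n)) \le \alpha_{\mathrm{ER}(d)}\right] \to 1 \quad \text{as } n \to \infty .$$
   Context: A subset $S$ of the vertex set $V(G)$ of a finite graph $G$ is a percolation set with clusters of size at most $\tau$ if all connected components of the induced subgraph $G[S]$ have at most $\tau$ vertices. Define $$\alpha^{\tau}(G) = \max\left\{ \frac{|S|}{|V(G)|} : S \subset V(G) \text{ is a percolation set with clusters of size at most } \tau\right\}.$$ $\mathrm{ER}(n,p)$ denotes the Erdős–Rényi random graph on $n$ vertices in which every pair of vertices is independently included as an edge with probability $p$. $\log$ is the natural logarithm. *)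

(* Defs.v *)
From mathcomp Require Import all_boot all_order all_algebra.
From mathcomp Require Import all_classical all_reals all_analysis.

Set Implicit Arguments.
Unset Strict Implicit.
Unset Printing Implicit Defensive.

Import Order.TTheory GRing.Theory Num.Theory.
Import numFieldNormedType.Exports.

Local Open Scope ring_scope.

Definition vpair (T : finType) : finType := {e : {set T} | #|e| == 2%N}.

(* A finite simple graph with vertex set T is given by its set of edges. *)
Definition sgraph (T : finType) : finType := {set vpair T}.

Definition adj (T : finType) (G : sgraph T) : rel T :=
  fun x y => [exists e : vpair T, (e \in G) && (val e == [set x; y]%SET)].

Definition induced_adj (T : finType) (G : sgraph T) (S : {set T}) : rel T :=
  fun x y => [&& x \in S, y \in S & adj G x y].

Definition components (T : finType) (G : sgraph T) (S : {set T}) :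
    {set {set T}} :=
  equivalence_partition (connect (induced_adj G S)) S.

Definition percolation_set (T : finType) (tau : nat) (G : sgraph T)
    (S : {set T}) : bool :=
  [forall C in components G S, #|C| <= tau]%N.

(* The default value 0 is harmless: the empty set is a percolation set, and
   all the ratios are nonnegative. *)
Definition alpha (R : realType) (T : finType) (tau : nat) (G : sgraph T) : R :=
  \big[Order.max/0]_(S : {set T} | percolation_set tau G S)
     (#|S|%:R / #|T|%:R).

(* Pr[ER(n, p) \in A]. This is a probability only for 0 <= p <= 1; for
   p = d / n it is so as soon as n >= d, which suffices for limits in n. *)
Definition ER_weight (R : realType) (n : nat) (p : R) (G : sgraph 'I_n) : R :=
  \prod_(e : vpair 'I_n) (if e \in G then p else 1 - p).

Definition ER_prob (R : realType) (n : nat) (p : R) (A : pred (sgraph 'I_n)) : R :=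
  \sum_(G : sgraph 'I_n | A G) ER_weight p G.

Definition alpha_ER (R : realType) (d : R) : R := 2 / d * (ln d + 2 - ln 2).

(* Main.v *)
Require Import Defs.
From mathcomp Require Import all_boot all_order all_algebra.
From mathcomp Require Import all_classical all_reals all_analysis.
From mathcomp Require Import lra.

Import Order.TTheory GRing.Theory Num.Theory.
Import numFieldNormedType.Exports.

Local Open Scope classical_set_scope.
Local Open Scope ring_scope.

(** Why the theorem holds.  A first moment argument.  Write e(S) for the number
    of edges inside a vertex set S, p = d / n, and a for the threshold
    [alpha_ER d].

    A cluster with more edges than vertices is rare: a set of v vertices spans
    at least v + 1 edges with probability O(n ^- (v + 1)), and there are at most
    n ^ v such sets, so for bounded v the expected number of such sets is
    O(1 / n) ([prob_dense_small_set]).  Outside this event, every cluster of a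
    percolation set S has at most as many edges as vertices, and adding up over
    the clusters gives e(S) <= |S| ([percolation_edges_le]).  It remains to
    exclude the sets S with |S| > a n and e(S) <= |S|.

    Such an S spans on average about (d / 2) a |S| = b |S| edges, where
    b = ln d + 2 - ln 2 = ln (d / 2) + 2 is greater than 1.  Chernoff's bound
    makes e(S) <= |S| as unlikely as (b e^(1 - b))^|S| up to a constant factor
    ([prob_sparse_set]).  The value of a is the one for which this base equals
    a / e.  Since |S| > a n, the union bound over all S is then at most a
    constant times
      e^(- a n) * sum_S a^|S| = ((1 + a) e^(- a))^n,
    which tends to 0 because 1 + a < e^a ([prob_sparse_large_set]).  The second
    order term of e^a is thus what allows S to be only barely larger than a n.

    Both tail estimates come from one exponential moment computation,
    [ER_chernoff], with x < 1 for the lower tail and x > 1 for the upper one. *)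

(** * Edges inside vertex sets and percolation sets *)

Definition edges_in {T : finType} (G : sgraph T) (S : {set T}) : {set vpair T} :=
  [set e in G | val e \subset S]%SET.

Lemma card_pairs_in (T : finType) (S : {set T}) :
  #|[set e : vpair T | val e \subset S]%SET| = 'C(#|S|, 2).
Proof.
rewrite -cards_draws -(card_imset _ (@val_inj _ _ (vpair T))).
apply: eq_card => A; rewrite inE; apply/imsetP/andP => [[e + ->]|[sAS cA]].
  by rewrite inE => ->; rewrite (valP e).
by exists (Sub A cA : vpair T); rewrite ?inE SubK.
Qed.

Lemma adjC (T : finType) (G : sgraph T) : symmetric (adj G).
Proof. by move=> x y; apply: eq_existsb => e; rewrite finset.setUC. Qed.

Lemma induced_adjC (T : finType) (G : sgraph T) (S : {set T}) :
  symmetric (induced_adj G S).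
Proof. by move=> x y; rewrite /induced_adj adjC andbCA. Qed.

Lemma components_partition (T : finType) (G : sgraph T) (S : {set T}) :
  finset.partition (components G S) S.
Proof.
apply: equivalence_partitionP => x y z _ _ _; split => //.
move=> cxy; exact: (same_connect (sym_connect_sym (induced_adjC T G S)) cxy z).
Qed.

(** An edge inside S connects its two ends within S, so it cannot join two
    different clusters. *)
Lemma edges_in_components (T : finType) (G : sgraph T) (S : {set T}) :
  edges_in G S \subset (\bigcup_(C in components G S) edges_in G C)%SET.
Proof.
apply/fintype.subsetP => e; rewrite inE => /andP[eG eS].
have /cards2P[x [y [_ exy]]] := valP e.
have xS : x \in S by apply: (fintype.subsetP eS); rewrite exy !inE eqxx.
have yS : y \in S by apply: (fintype.subsetP eS); rewrite exy !inE eqxx orbT.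
pose C := [set z in S | connect (induced_adj G S) x z]%SET.
apply/finset.bigcupP; exists C; first by apply/imsetP; exists x.
rewrite inE eG exy finset.subUset !finset.sub1set !inE xS yS connect0 /=.
apply: connect1; rewrite /induced_adj xS yS /=.
by apply/existsP; exists e; rewrite eG exy eqxx.
Qed.

Lemma leq_card_bigcup (I T : finType) (P : {pred I}) (F : I -> {set T}) :
  (#|(\bigcup_(i in P) F i)%SET| <= \sum_(i in P) #|F i|)%N.
Proof.
elim/big_rec2: _ => [|i m A _ le_Am]; first by rewrite cards0.
by rewrite (leq_trans (leq_card_setU _ _)) // leq_add2l.
Qed.

(** The only way in which the cluster size bound enters the probabilistic
    argument: it turns a local sparsity condition into a global one.  The bound
    |S| on the number of edges, rather than the |S| - 1 of a forest, is what
    unicyclic clusters allow. *)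
Lemma percolation_edges_le (T : finType) (tau : nat) (G : sgraph T) (S : {set T}) :
  (forall U : {set T}, #|U| <= tau -> #|edges_in G U| <= #|U|)%N ->
  percolation_set tau G S -> (#|edges_in G S| <= #|S|)%N.
Proof.
move=> sparse /'forall_implyP small.
rewrite (card_partition (components_partition T G S)).
apply: leq_trans (subset_leq_card (edges_in_components T G S)) _.
apply: leq_trans (leq_card_bigcup _ _ _ _) _.
by apply: leq_sum => C CP; apply/sparse/small.
Qed.

(** * Probabilities in the random graph *)

Lemma ER_weight_ge0 {R : realType} {n : nat} (p : R)
    (G : sgraph 'I_n) : 0 <= p <= 1 -> 0 <= ER_weight p G.
Proof.
by case/andP=> p0 p1; apply: prodr_ge0 => e _; case: ifP => _ //; rewrite subr_ge0.
Qed.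

Lemma ER_prob_predT {R : realType} {n : nat} (p : R) :
  ER_prob p (@predT (sgraph 'I_n)) = 1.
Proof.
rewrite /ER_prob /ER_weight -(bigA_distr (R:=R) _ _ (fun=> p) (fun=> 1 - p)).
by rewrite big1// => e _ /=; rewrite addrC subrK.
Qed.

Lemma ER_probC {R : realType} {n : nat} (p : R)
    (A : pred (sgraph 'I_n)) : ER_prob p A = 1 - ER_prob p (predC A).
Proof. by rewrite -(@ER_prob_predT R n p) /ER_prob (bigID A predT) /= addrK. Qed.

Lemma ER_prob_ge0 {R : realType} {n : nat} (p : R)
    (A : pred (sgraph 'I_n)) : 0 <= p <= 1 -> 0 <= ER_prob p A.
Proof. by move=> p01; apply: sumr_ge0 => G _; apply: ER_weight_ge0. Qed.

Lemma ER_prob_sub {R : realType} {n : nat} (p : R)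
    (A B : pred (sgraph 'I_n)) : 0 <= p <= 1 ->
  (forall G, A G -> B G) -> ER_prob p A <= ER_prob p B.
Proof.
move=> p01 sAB; rewrite /ER_prob big_mkcond [leRHS]big_mkcond /=.
apply: ler_sum => G _; case: ifP => [/sAB->//|_].
by case: ifP => // _; apply: ER_weight_ge0.
Qed.

Lemma ER_prob_union {R : realType} {n : nat} (p : R)
    (I : finType) (P : pred I) (B : I -> pred (sgraph 'I_n)) :
  0 <= p <= 1 ->
  ER_prob p (fun G => [exists (i | P i), B i G]) <= \sum_(i | P i) ER_prob p (B i).
Proof.
move=> p01; rewrite /ER_prob (exchange_big_dep predT)//= big_mkcond /=.
apply: ler_sum => G _; have w0 := ER_weight_ge0 p G p01.
case: ifP => [/exists_inP[i Pi BiG]|_]; last exact: sumr_ge0.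
rewrite (bigD1 i) ?Pi ?BiG //= lerDl; exact: sumr_ge0.
Qed.

(** Exponential Markov inequality: x^(e(S) - m) is at least 1 on A, and the
    independence of the edges gives E x^e(S) = (1 - p + p x)^(number of pairs
    in S).  Stating the hypothesis through powers of x covers the upper tail
    e(S) >= m (with x >= 1) and the lower tail e(S) <= m (with x <= 1). *)
Lemma ER_chernoff {R : realType} {n : nat} (p : R)
    (S : {set 'I_n}) (x : R) (m : nat) (A : pred (sgraph 'I_n)) :
  0 <= p <= 1 -> 0 < x -> (forall G, A G -> x ^+ m <= x ^+ #|edges_in G S|) ->
  ER_prob p A <= (1 - p + p * x) ^+ 'C(#|S|, 2) / x ^+ m.
Proof.
move=> p01 x0 Ax; have xm0 : 0 < x ^+ m by rewrite exprn_gt0.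
rewrite ler_pdivlMr//.
pose c (e : vpair 'I_n) : R := if val e \subset S then x else 1.
have cprod (G : sgraph 'I_n) : ER_weight p G * x ^+ #|edges_in G S| =
    \prod_(e : vpair 'I_n) (if e \in G then p * c e else 1 - p).
  rewrite -prodr_const big_mkcond /= -big_split /=; apply: eq_bigr => e _.
  by rewrite inE /c; case: (e \in G); rewrite /= ?mulr1.
have -> : (1 - p + p * x) ^+ 'C(#|S|, 2) =
    \sum_(G : sgraph 'I_n) ER_weight p G * x ^+ #|edges_in G S|.
  under eq_bigr do rewrite cprod.
  rewrite -(bigA_distr (R:=R) _ _ (fun e => p * c e) (fun=> 1 - p)) -card_pairs_in.
  rewrite -prodr_const [LHS]big_mkcond /=; apply: eq_bigr => e _.
  by rewrite inE /c; case: ifP => _; rewrite addrC ?mulr1 ?subrK.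
rewrite /ER_prob mulr_suml big_mkcond /=; apply: ler_sum => G _.
have w0 := ER_weight_ge0 p G p01.
case: ifP => [/Ax|_]; first exact: ler_wpM2l.
by rewrite mulr_ge0// exprn_ge0// ltW.
Qed.

(** * The two exceptional events *)

(** Summing over all vertex sets at once, weighted by their size, avoids
    binomial coefficients in the union bounds below. *)
Lemma sum_expr_card (R : comNzRingType) (T : finType) (t : R) :
  \sum_(S : {set T}) t ^+ #|S| = (1 + t) ^+ #|T|.
Proof.
rewrite -prodr_const (bigA_distr (R:=R) _ _ (fun=> 1) (fun=> t)).
rewrite (reindex_inj (can_inj (@finset.setCK T))); apply: eq_bigr => S _.
rewrite -prodr_const big_mkcond; apply: eq_bigr => i _.
by rewrite finset.in_setC; case: (i \in S).
Qed.

(** A set U spans at least |U| + 1 of its at most 'C(tau, 2) pairs with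
    probability at most 2 ^ 'C(tau, 2) * p ^ (|U| + 1), and the sum of p ^ |U|
    over all U is (1 + p) ^ n <= e ^ (n p), which is bounded when p = d / n.
    The extra factor p makes the event rare. *)
Lemma prob_dense_small_set (R : realType) (n tau : nat) (p : R) : 0 < p <= 1 ->
  ER_prob p (fun G : sgraph 'I_n =>
      [exists (U : {set 'I_n} | (#|U| <= tau)%N), (#|U| < #|edges_in G U|)%N])
    <= 2 ^+ 'C(tau, 2) * p * expR (n%:R * p).
Proof.
case/andP=> p0 p1; have p01 : 0 <= p <= 1 by rewrite (ltW p0).
apply: le_trans (ER_prob_union p _ (fun U : {set 'I_n} => #|U| <= tau)%N
  (fun U G => #|U| < #|edges_in G U|)%N p01) _.
apply: (@le_trans _ _ (\sum_(U : {set 'I_n}) 2 ^+ 'C(tau, 2) * p * p ^+ #|U|)).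
  rewrite [leLHS]big_mkcond; apply: ler_sum => U _; case: ifP => [leU|_]; last first.
    by rewrite !mulr_ge0 ?exprn_ge0 ?ltW.
  (* x = 1 / p turns the moment 1 - p + p x into a number at most 2 *)
  apply: le_trans (ER_chernoff p U p^-1 #|U|.+1 _ p01 _ _) _.
  - by rewrite invr_gt0.
  - by move=> G ltU; rewrite ler_weXn2l// invf_ge1.
  rewrite divff ?gt_eqF// -exprVn invrK exprS mulrA.
  rewrite ler_wpM2r ?exprn_ge0 ?(ltW p0)// ler_pM2r//.
  apply: (@le_trans _ _ (2 ^+ 'C(#|U|, 2))).
    by rewrite lerXn2r ?nnegrE//; lra.
  by rewrite ler_weXn2l ?ler1n// leq_bin2l.
rewrite -mulr_sumr sum_expr_card card_ord ler_wpM2l ?mulr_ge0 ?exprn_ge0 ?(ltW p0)//.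
rewrite expRM_natl.
by rewrite lerXn2r ?nnegrE ?expR_ge0 ?expR_ge1Dx ?addr_ge0 ?(ltW p0).
Qed.

(** Lower tail of e(S), whose mean p |S| (|S| - 1) / 2 is at least
    b (|S| - 1).  The optimal parameter in Chernoff's bound for a mean b |S|
    and a threshold |S| is x = 1 / b; the factor e^(b - 1) pays for the
    difference between |S| - 1 and |S|. *)
Lemma prob_sparse_set (R : realType) (n : nat) (p b : R) (S : {set 'I_n}) :
  0 <= p <= 1 -> 1 <= b -> 2 * b <= p * #|S|%:R ->
  ER_prob p (fun G : sgraph 'I_n => #|edges_in G S| <= #|S|)%N
    <= expR (b - 1) * (b * expR (1 - b)) ^+ #|S|.
Proof.
move=> p01 b1 bS; have [p0 p1] := andP p01; have b0 : 0 < b by lra.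
apply: le_trans (ER_chernoff p S b^-1 #|S| _ p01 _ _) _.
- by rewrite invr_gt0.
- by move=> G leS; rewrite ler_wiXn2l// ?invf_le1// invr_ge0 ltW.
rewrite -exprVn invrK exprMn mulrCA mulrC ler_pM2l ?exprn_gt0//.
move: bS; case: #|S| => [|k]; first by lra.
move=> bS; have N2 : 2 * 'C(k.+1, 2)%:R = k.+1%:R * k%:R :> R.
  by rewrite -!natrM -mul_bin_diag bin1.
apply: (@le_trans _ _ (expR ('C(k.+1, 2)%:R * (- p * (1 - b^-1))))).
  rewrite expRM_natl lerXn2r ?nnegrE ?expR_ge0//.
    by rewrite addr_ge0 ?subr_ge0// mulr_ge0 ?invr_ge0// ltW.
  by apply: le_trans (expR_ge1Dx _); lra.
rewrite -expRM_natl -expRD ler_expR.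
have Np : b * k%:R <= 'C(k.+1, 2)%:R * p.
  have k0 : 0 <= k%:R :> R by [].
  have : 2 * b * k%:R <= p * k.+1%:R * k%:R by rewrite ler_wpM2r.
  by rewrite -mulrA -[X in _ <= X]mulrA -N2; lra.
have c0 : 0 <= 1 - b^-1 by rewrite subr_ge0 invf_le1.
have := ler_wpM2r c0 Np.
have -> : b * k%:R * (1 - b^-1) = k%:R * (b - 1).
  by rewrite mulrBr mulr1 mulrAC divff ?gt_eqF//; lra.
by rewrite -natr1; lra.
Qed.

(** Union bound over all S with |S| > a n: each has probability at most
    e^(b - 1) a^|S| e^(- |S|), and e^(- |S|) <= e^(- a n). *)
Lemma prob_sparse_large_set (R : realType) (n : nat) (p a b : R) :
  0 <= p <= 1 -> 1 <= b -> 0 <= a -> 2 * b <= p * (a * n%:R) ->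
  b * expR (1 - b) <= a * expR (- 1) ->
  ER_prob p (fun G : sgraph 'I_n =>
      [exists (S : {set 'I_n} | a * n%:R < #|S|%:R), (#|edges_in G S| <= #|S|)%N])
    <= expR (b - 1) * ((1 + a) * expR (- a)) ^+ n.
Proof.
move=> p01 b1 a0 ban bea; have [p0 p1] := andP p01.
apply: le_trans (ER_prob_union p _ (fun S : {set 'I_n} => a * n%:R < #|S|%:R)
  (fun S G => #|edges_in G S| <= #|S|)%N p01) _.
apply: (@le_trans _ _ (\sum_(S : {set 'I_n})
    expR (b - 1) * expR (- a) ^+ n * a ^+ #|S|)); last first.
  rewrite -mulr_sumr sum_expr_card card_ord -mulrA ler_wpM2l ?expR_ge0//.
  by rewrite -exprMn mulrC.
rewrite [leLHS]big_mkcond; apply: ler_sum => S _; case: ifP => [ltS|_]; last first.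
  by rewrite !mulr_ge0 ?exprn_ge0 ?expR_ge0.
apply: le_trans (prob_sparse_set _ _ _ b S p01 b1 _) _.
  by apply: le_trans ban _; rewrite ler_wpM2l// ltW.
rewrite -mulrA ler_wpM2l ?expR_ge0//.
apply: (@le_trans _ _ ((a * expR (- 1)) ^+ #|S|)).
  by rewrite lerXn2r ?nnegrE ?mulr_ge0 ?expR_ge0//; lra.
rewrite exprMn mulrC ler_wpM2r ?exprn_ge0//.
by rewrite -!expRM_natl ler_expR; lra.
Qed.

(** * The percolation ratio *)

Lemma alpha_gt_witness (R : realType) (T : finType) (tau : nat) (a : R)
    (G : sgraph T) : 0 <= a -> ~~ (alpha R tau G <= a) ->
  exists2 S : {set T}, percolation_set tau G S & a < #|S|%:R / #|T|%:R.
Proof.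
move=> a0; apply: contraNP => noS; apply: bigmax_le => // S percS.
by rewrite leNgt; apply/negP => ltS; apply: noS; exists S.
Qed.

(** Here the threshold meets the Chernoff base: with b = ln (d / 2) + 2 one has
    e^(1 - b) = (2 / d) / e, hence b e^(1 - b) = (2 b / d) / e = a / e. *)
Lemma ER_prob_alpha_gt (R : realType) (n tau : nat) (d : R) :
  5 <= d -> d <= n%:R ->
  ER_prob (d / n%:R) (fun G : sgraph 'I_n => ~~ (alpha R tau G <= alpha_ER d))
    <= 2 ^+ 'C(tau, 2) * (d / n%:R) * expR d
       + expR (ln d + 1 - ln 2)
         * ((1 + alpha_ER d) * expR (- alpha_ER d)) ^+ n.
Proof.
move=> d5 dn; have d0 : 0 < d by lra.
have n0 : 0 < n%:R :> R by lra.
set p := d / n%:R; set a := alpha_ER d; pose b := ln d + 2 - ln 2.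
have p0 : 0 < p by rewrite divr_gt0.
have p1 : p <= 1 by rewrite ler_pdivrMr// mul1r.
have p01 : 0 <= p <= 1 by rewrite (ltW p0).
have b1 : 1 <= b.
  by have : ln 2 <= ln d; [rewrite ler_ln ?posrE//; lra|rewrite /b; lra].
have abd : a = 2 / d * b by [].
have a0 : 0 <= a by rewrite abd mulr_ge0 ?divr_ge0//; lra.
have pn : n%:R * p = d by rewrite mulrC divfK ?gt_eqF.
pose A1 (G : sgraph 'I_n) :=
  [exists (U : {set 'I_n} | (#|U| <= tau)%N), (#|U| < #|edges_in G U|)%N].
pose A2 (G : sgraph 'I_n) :=
  [exists (S : {set 'I_n} | a * n%:R < #|S|%:R), (#|edges_in G S| <= #|S|)%N].
apply: (@le_trans _ _ (ER_prob p A1 + ER_prob p A2)); last first.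
  apply: lerD.
    by rewrite -[in expR d]pn; apply: prob_dense_small_set; rewrite p0.
  have -> : ln d + 1 - ln 2 = b - 1 by rewrite /b; lra.
  apply: prob_sparse_large_set => //.
    by rewrite mulrCA [p * _]mulrC pn abd mulrAC divfK ?gt_eqF.
  have -> : 1 - b = - 1 + (ln 2 - ln d) by rewrite /b; lra.
  rewrite expRD -ln_div ?posrE// lnK ?posrE ?divr_gt0// abd.
  by rewrite [expR _ * _]mulrC mulrA [b * _]mulrC.
have sAU G : ~~ (alpha R tau G <= a) -> A1 G || A2 G.
  case/(alpha_gt_witness _ _ _ _ _ a0) => S percS; rewrite card_ord => ltS.
  apply/orP; have [|noA1] := boolP (A1 G); [by left|right].
  apply/exists_inP; exists S; first by rewrite -ltr_pdivlMr.
  apply: percolation_edges_le percS => U leU; rewrite leqNgt.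
  by apply: contra noA1 => ltU; apply/exists_inP; exists U.
apply: (@le_trans _ _ (ER_prob p (fun G => A1 G || A2 G))).
  exact: ER_prob_sub.
rewrite /ER_prob [in leRHS]big_mkcond [X in _ + X]big_mkcond -big_split /=.
rewrite big_mkcond; apply: ler_sum => G _; have w0 := ER_weight_ge0 p G p01.
by case: (A1 G); case: (A2 G); rewrite /= ?addr0 ?add0r// lerDl.
Qed.

Theorem corollary2p1 (R : realType) (d : R) (hd : 5 <= d)
    (tau : nat) (htau : (1 <= tau)%N) :
  (fun n : nat => ER_prob (d / n%:R)
     (fun G : sgraph 'I_n => alpha R tau G <= alpha_ER d)) @ \oo --> (1 : R).
Proof.
set a := alpha_ER d; have d0 : 0 < d by lra.
have a0 : 0 < a.
  rewrite /a /alpha_ER mulr_gt0 ?divr_gt0//.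
  by have : ln 2 <= ln d; [rewrite ler_ln ?posrE//; lra|lra].
pose q := (1 + a) * expR (- a).
have q1 : `|q| < 1.
  rewrite ger0_norm ?mulr_ge0 ?expR_ge0//; last by lra.
  by rewrite /q expRN ltr_pdivrMr ?expR_gt0// mul1r expR_gt1Dx// gt_eqF.
(* the factor 2 comes from 1 / n <= 2 / (n + 1), as the harmonic sequence is
   indexed from 0 *)
pose K1 := 2 ^+ 'C(tau, 2) * d * expR d * 2; pose K2 := expR (ln d + 1 - ln 2).
pose err (n : nat) : R := K1 * harmonic n + geometric K2 q n.
have err0 : err n @[n --> \oo] --> (0 : R).
  rewrite -[X in _ --> X]addr0; apply: cvgD; last exact: cvg_geometric.
  by rewrite -[X in _ --> X](mulr0 K1); apply: cvgMr; exact: cvg_harmonic.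
apply: (@squeeze_cvgr _ _ _ _ (fun n => 1 - err n) (fun=> 1)); last 2 first.
- by rewrite -[X in _ --> X]subr0; apply: cvgB => //; exact: cvg_cst.
- exact: cvg_cst.
near=> n.
have dn : d <= n%:R by near: n; exact: nbhs_infty_ger.
have n0 : 0 < n%:R :> R by lra.
have p01 : 0 <= d / n%:R <= 1.
  by rewrite divr_ge0 ?(ltW d0) ?(ltW n0)//= ler_pdivrMr// mul1r.
rewrite ER_probC lerD2l lerN2 gerBl ER_prob_ge0 // andbT.
apply: le_trans (ER_prob_alpha_gt _ _ _ _ hd dn) _.
rewrite /err /geometric /= lerD2r /K1 -!mulrA ler_pM2l ?exprn_gt0//.
rewrite ler_pM2l// mulrC ler_pM2l ?expR_gt0//.
rewrite ler_pdivlMr// mulrC ler_pdivrMr// -natr1.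
by have : 1 <= n%:R :> R; [lra|lra].
Unshelve. all: by end_near.
Qed.
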